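(* Let $P,Q,R\in D_P$ be pairwise distinct. Let $T_1,T_2\in S^1$ be the two endpoints at infinity of the hyperbolic line through $P$ and $Q$. Let $C_1,C_2$ be the two circular arcs in $D_P$ with endpoints $T_1,T_2$, lying on opposite sides of the hyperbolic line $PQ$, each meeting $S^1$ at $T_1$ and at $T_2$ with angle $2\arctan(e^{d(P,Q)})-\pi/2$. Let $\Theta$ be the open region of $D_P$ bounded by $C_1$ and $C_2$ (the region containing the hyperbolic line $PQ$). Let $m$ be the number of ideal triangles circumscribing $\triangle PQR$. Then $$m=\begin{cases}0 & \text{if } R\in\Theta,\\ 1 & \text{if } R\in C_1\cup C_2,\\ 2 & \text{if } R\in D_P\setminus \overline{\Theta}.\end{cases}$$
   Context: $D_P=\{z\in\mathbb{C}:|z|<1\}$ is the Poincaré disk with metric $ds^2=4\frac{dx^2+dy^2}{(1-x^2-y^2)^2}$ and boundary at infinity $S^1=\{|z|=1\}$; hyperbolic lines are arcs of circles or diameters orthogonal to $S^1$; $d$ is the hyperbolic distance, $d(P,Q)=\operatorname{arccosh}\left(1+\frac{2|P-Q|^2}{(1-|P|^2)(1-|Q|^2)}\right)$. An ideal triangle circumscribing $\triangle PQR$ is a triangle whose three vertices are distinct points of $S^1$ and whose sides are hyperbolic lines joining them, such that $P$, $Q$, $R$ lie on three distinct sides (one point on each side). *)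

(* Defs.v *)
From HB Require Import structures.
From mathcomp Require Import all_boot all_order all_algebra.
From mathcomp Require Import all_classical all_reals all_analysis.
Set Implicit Arguments. Unset Strict Implicit. Unset Printing Implicit Defensive.
Import Order.TTheory GRing.Theory Num.Theory.
Import numFieldTopology.Exports.
Local Open Scope ring_scope.
Local Open Scope classical_set_scope.

Section PoincareDisk.
Variable R : realType.
Local Notation pt := (R * R)%type.

Definition dotp (u v : pt) : R := u.1 * v.1 + u.2 * v.2.
Definition norm2 (u : pt) : R := dotp u u.
Definition subp (u v : pt) : pt := (u.1 - v.1, u.2 - v.2).
Definition scalep (t : R) (u : pt) : pt := (t * u.1, t * u.2).
Definition oppp (u : pt) : pt := (- u.1, - u.2).

Definition disk : set pt := [set z | norm2 z < 1].
Definition S1 : set pt := [set z | norm2 z = 1].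

Definition arccosh (X : R) : R := ln (X + Num.sqrt (X ^+ 2 - 1)).
Definition hdist (P Q : pt) : R :=
  arccosh (1 + 2 * norm2 (subp P Q) / ((1 - norm2 P) * (1 - norm2 Q))).

(* The hyperbolic line with (distinct) ideal endpoints a, b in S^1: the part in
   D_P of either a circle orthogonal to S^1 (centre c, radius r, |c|^2 = 1 + r^2)
   through a and b, or a diameter (when b = -a). *)
Definition hline (a b : pt) : set pt :=
  [set z | disk z /\
    ((exists (c : pt) (r : R), [/\ 0 < r, norm2 c = 1 + r ^+ 2,
        norm2 (subp a c) = r ^+ 2, norm2 (subp b c) = r ^+ 2 &
        norm2 (subp z c) = r ^+ 2])
     \/ (b = oppp a /\ exists t : R, z = scalep t a))].

(* Generalized circle (circle or straight line) of equation
   k |z|^2 + <w, z> + e = 0, non-degenerate when |w|^2 > 4 k e. *)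
Definition gcirc_eq (k : R) (w : pt) (e : R) (z : pt) : R :=
  k * norm2 z + dotp w z + e.
Definition gcircle (k : R) (w : pt) (e : R) : set pt := [set z | gcirc_eq k w e z = 0].
Definition gcircle_nondeg (k : R) (w : pt) (e : R) : Prop := 4 * k * e < norm2 w.
(* normal vector (gradient of the equation) at z *)
Definition gcirc_normal (k : R) (w : pt) (z : pt) : pt :=
  (2 * k * z.1 + w.1, 2 * k * z.2 + w.2).

(* (unoriented) angle between two curves at an intersection point, i.e. the
   angle in [0, pi/2] between their tangent lines, computed from normals *)
Definition angle_normals (n1 n2 : pt) : R :=
  acos (`|dotp n1 n2| / (Num.sqrt (norm2 n1) * Num.sqrt (norm2 n2))).
(* angle at T in S^1 between the generalized circle and S^1 (whose normal at T is T) *)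
Definition angle_with_S1 (k : R) (w : pt) (T : pt) : R :=
  angle_normals (gcirc_normal k w T) T.

(* set of ideal triangles circumscribing the triangle PQR, each ideal triangle
   being identified with its (unordered) set of three vertices *)
Definition circ_ideal_triangles (P Q Rp : pt) : set (set pt) :=
  [set V | exists A B C : pt,
     [/\ S1 A, S1 B, S1 C & [/\ A <> B, B <> C & A <> C]] /\
     V = [set A; B; C] /\
     [/\ hline B C P, hline C A Q & hline A B Rp]].

End PoincareDisk.
Arguments disk {R}.
Arguments S1 {R}.
Notation pt R := (R * R)%type (only parsing).

(* Main.v *)
(* An ideal triangle ABC with P on BC, Q on CA and R on AB is a fixed point B of the
   composition of the half-turns about P, Q, R acting on S^1. Identifying S^1 with the
   real projective line, these fixed points are the roots of a binary quadratic form of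
   discriminant 4 (D^2 - N^2), where D is the determinant of the hyperboloid lifts
   (1 + |z|^2, 2 z) of P, Q, R and N the product of the 1 - |z|^2.
   For fixed P, Q, the equations D = N and D = - N in R are the two circles through T1
   and T2 that meet S^1 at the prescribed angle, whose cosine is 1 / cosh d(P, Q).
   Finally D^2 < N^2 is the region between them: it is convex in the Klein model, so
   that Klein segments to P connect it. *)

Require Import Defs.
From HB Require Import structures.
From mathcomp Require Import all_boot all_order all_algebra.
From mathcomp Require Import all_classical all_reals all_analysis.
From mathcomp Require Import ring lra.
Import Order.TTheory GRing.Theory Num.Theory.
Import numFieldTopology.Exports.
Local Open Scope ring_scope.
Local Open Scope classical_set_scope.

Section IdealTriangles.
Variable R : realType.
Implicit Types (a b c z p q r P Q : pt R).

(** * Hyperbolic lines as chords of the Klein model *)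

Definition wedge a b : R := a.1 * b.2 - a.2 * b.1.

(* The chord of [S^1] joining [circle_point p] to [circle_point q] passes through the
   Klein-model image [2 z / (1 + |z|^2)] of [z] iff this (positive definite) symmetric
   bilinear form vanishes at [(p, q)]. *)
Definition lift_form z p q : R :=
  (1 + norm2 z - 2 * z.1) * (p.1 * q.1) + (1 + norm2 z + 2 * z.1) * (p.2 * q.2)
  - 2 * z.2 * (p.1 * q.2 + p.2 * q.1).

(** A linear map inducing the half-turn about [z] on the projective line of parameters [p]: it
    exchanges the ends of every chord through the Klein image of [z]. Its matrix has trace 0. *)
Definition polar z p : pt R :=
  (2 * z.2 * p.1 - (1 + norm2 z + 2 * z.1) * p.2,
   (1 + norm2 z - 2 * z.1) * p.1 - 2 * z.2 * p.2).

(* If [p] has polar angle [t], this is the point of polar angle [2 t]. *)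
Definition circle_point p : pt R :=
  scalep (norm2 p)^-1 (p.1 ^+ 2 - p.2 ^+ 2, 2 * p.1 * p.2).

Lemma pt_eq a b : a.1 = b.1 -> a.2 = b.2 -> a = b.
Proof. by case: a b => [? ?] [? ?] /= -> ->. Qed.

Lemma sqr_sum_eq0 (x y : R) : x ^+ 2 + y ^+ 2 = 0 -> x = 0 /\ y = 0.
Proof.
move=> /eqP; rewrite paddr_eq0 ?sqr_ge0// !sqrf_eq0 => /andP[/eqP -> /eqP ->] //.
Qed.

Lemma norm2_ge0 z : 0 <= norm2 z.
Proof. by rewrite /norm2 /dotp -!expr2 addr_ge0 ?sqr_ge0. Qed.

Lemma norm2_eq0 p : norm2 p = 0 -> p = (0, 0).
Proof.
rewrite /norm2 /dotp -!expr2 => /sqr_sum_eq0[h1 h2]; exact: pt_eq.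
Qed.

Lemma norm2_gt0 p : p <> (0, 0) -> 0 < norm2 p.
Proof.
move=> np; rewrite lt_neqAle; apply/andP; split.
  by apply/eqP => /esym /norm2_eq0.
exact: norm2_ge0.
Qed.

(** By Lagrange's identity [dotp a b] squares to 1, and [b] equals its projection [(dotp a b) a]. *)
Lemma S1_wedge0 a b : S1 a -> S1 b -> wedge a b = 0 -> a = b \/ b = oppp a.
Proof.
rewrite /S1 /wedge /norm2 /dotp /oppp /=; case: a b => [a1 a2] [b1 b2] /= ha hb w.
have d2 : (a1 * b1 + a2 * b2) ^+ 2 = 1.
  transitivity ((a1 * a1 + a2 * a2) * (b1 * b1 + b2 * b2)
     - (a1 * b2 - a2 * b1) ^+ 2); first by ring.
  by rewrite ha hb w; ring.
have e1 : b1 = (a1 * b1 + a2 * b2) * a1 .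
  transitivity ((a1 * b1 + a2 * b2) * a1  - (a1 * b2 - a2 * b1) * a2
     + (1 - (a1 * a1 + a2 * a2)) * b1); first by ring.
  by rewrite w ha; ring.
have e2 : b2 = (a1 * b1 + a2 * b2) * a2.
  transitivity ((a1 * b1 + a2 * b2) * a2 + (a1 * b2 - a2 * b1) * a1
     + (1 - (a1 * a1 + a2 * a2)) * b2); first by ring.
  by rewrite w ha; ring.
by move/eqP: d2; rewrite sqrf_eq1 => /orP[] /eqP d; [left|right];
  congr pair; move: e1 e2; rewrite d; lra.
Qed.

(** The linear equation says that the Klein image [2 z / (1 + |z|^2)] lies on the chord [ab]; it
    covers circles and diameters uniformly. For a circle, subtracting the equations gives
    [dotp a c = dotp b c = 1] and [2 dotp z c = 1 + |z|^2], so the centre is the pole of the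
    chord. *)
Lemma hlineP a b z : S1 a -> S1 b -> a <> b ->
  hline a b z <-> disk z /\ (1 + norm2 z) * wedge a b = 2 * wedge z (subp b a).
Proof.
move=> Sa Sb nab; split.
  case=> dz [[c [r [r0 hc ha hb hz]]]|[-> [t ez]]]; split=> //.
    move: Sa Sb hc ha hb hz; rewrite /S1 /norm2 /wedge /subp /dotp /=.
    case: a b c z {nab dz} => [a1 a2] [b1 b2] [c1 c2] [z1 z2] /= Sa Sb hc ha hb hz.
    have ac : a1 * c1 + a2 * c2 = 1 by lra.
    have bc : b1 * c1 + b2 * c2 = 1 by lra.
    have -> : 1 + (z1 * z1 + z2 * z2) = 2 * (z1 * c1 + z2 * c2) by lra.
    transitivity (2 * ((a1 * c1 + a2 * c2) * (z1 * b2 - z2 * b1)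
       - (b1 * c1 + b2 * c2) * (z1 * a2 - z2 * a1))); first by ring.
    by rewrite ac bc; ring.
  by rewrite ez /wedge /subp /oppp /scalep /=; ring.
case=> dz h; split=> //; have [w0|w0] := eqVneq (wedge a b) 0.
  right; have [//|ba] := S1_wedge0 _ _ Sa Sb w0.
  split=> //; exists (dotp z a); move: h Sa; rewrite w0 ba.
  rewrite /S1 /norm2 /wedge /subp /oppp /dotp /scalep /=.
  case: a z {nab dz w0 ba} => [a1 a2] [z1 z2] /= h Sa.
  have w : z1 * a2 - z2 * a1 = 0 by lra.
  congr pair.
    transitivity (z1 * (a1 * a1 + a2 * a2)); first by rewrite Sa mulr1.
    transitivity ((z1 * a1 + z2 * a2) * a1 + (z1 * a2 - z2 * a1) * a2); first by ring.
    by rewrite w; ring.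
  transitivity (z2 * (a1 * a1 + a2 * a2)); first by rewrite Sa mulr1.
  transitivity ((z1 * a1 + z2 * a2) * a2 - (z1 * a2 - z2 * a1) * a1); first by ring.
  by rewrite w; ring.
(* [c] solves [dotp a c = dotp b c = 1] by Cramer's rule; the radius is the length [|wedge a c|] of
   the tangent from [c] to the unit circle. *)
left; pose c : pt R := scalep (wedge a b)^-1 (b.2 - a.2, a.1 - b.1).
have ac : dotp a c = 1.
  by rewrite /c /dotp /scalep /=; move: w0; rewrite /wedge => w0; field.
have bc : dotp b c = 1.
  by rewrite /c /dotp /scalep /=; move: w0; rewrite /wedge => w0; field.
have nc : norm2 c = 1 + `|wedge a c| ^+ 2.
  rewrite real_normK ?num_real//.
  transitivity (norm2 a * norm2 c); first by rewrite Sa mul1r.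
  rewrite -[1 in RHS](expr1n _ 2) -ac; rewrite /norm2 /wedge /dotp; ring.
have on x : S1 x -> dotp x c = 1 -> norm2 (subp x c) = `|wedge a c| ^+ 2.
  move=> Sx xc; have -> : norm2 (subp x c) = norm2 x - 2 * dotp x c + norm2 c.
    by rewrite /norm2 /subp /dotp /=; ring.
  by rewrite Sx xc nc; ring.
exists c, `|wedge a c|; split=> //.
- rewrite normr_gt0; apply/eqP => s0; apply: nab.
  have nc1 : norm2 c = 1 by rewrite nc s0 normr0; ring.
  have : norm2 (subp a c) = 0 by rewrite on// s0 normr0; ring.
  have : norm2 (subp b c) = 0 by rewrite on// s0 normr0; ring.
  rewrite /subp => /norm2_eq0[/eqP + /eqP +] /norm2_eq0[/eqP + /eqP +].
  by rewrite !subr_eq0 => /eqP h1 /eqP h2 /eqP h3 /eqP h4; apply: pt_eq; congruence.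
- exact: on.
- exact: on.
- have -> : norm2 (subp z c) = norm2 z - 2 * dotp z c + norm2 c.
    by rewrite /norm2 /subp /dotp /=; ring.
  have -> : 2 * dotp z c = 1 + norm2 z.
    apply: (mulIf w0); rewrite h /c /dotp /scalep /=.
    by move: w0; rewrite /wedge /subp /= => w0; field.
  by rewrite nc; ring.
Qed.

(** * The double-angle parametrization of the circle *)

Lemma circle_point_S1 p : p <> (0, 0) -> S1 (circle_point p).
Proof.
move=> /norm2_gt0 /lt0r_neq0; rewrite /S1 /circle_point /scalep /norm2 /dotp /= => h.
by field.
Qed.

(** Points of angles 2s and 2t are at squared distance [4 sin^2 (s - t)], so parameters matter only
    up to a scalar. *)
Lemma norm2_sub_circle_point p q : p <> (0, 0) -> q <> (0, 0) ->
  norm2 (subp (circle_point p) (circle_point q)) =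
  4 * wedge p q ^+ 2 / (norm2 p * norm2 q).
Proof.
move=> /norm2_gt0 /lt0r_neq0 hp /norm2_gt0 /lt0r_neq0 hq.
move: hp hq; rewrite /subp /wedge /circle_point /scalep /norm2 /dotp /= => hp hq.
by field; rewrite hp hq.
Qed.

Lemma circle_point_eqP p q : p <> (0, 0) -> q <> (0, 0) ->
  circle_point p = circle_point q <-> wedge p q = 0.
Proof.
move=> p0 q0; have := norm2_sub_circle_point p q p0 q0.
have := norm2_gt0 p p0; have := norm2_gt0 q q0 => hq hp E; split=> h.
  have s0 : norm2 (subp (circle_point q) (circle_point q)) = 0.
    by rewrite /norm2 /subp /dotp /=; ring.
  move/eqP: E; rewrite h s0 eq_sym !mulf_eq0 invr_eq0 mulf_eq0 (gt_eqF hp) (gt_eqF hq) !orbF.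
  by rewrite pnatr_eq0 /= orbb => /eqP.
move: E; rewrite h expr0n /= mulr0 mul0r => /norm2_eq0 [/eqP + /eqP].
by rewrite !subr_eq0 => /eqP h1 /eqP h2; apply: pt_eq.
Qed.

(** As a complex number, [1 + a] bisects the angle from 1 to [a]; it vanishes only at [a = -1],
    where [i] serves instead. *)
Lemma circle_point_surj a : S1 a -> exists2 p, p <> (0, 0) & circle_point p = a.
Proof.
case: a => [a1 a2]; rewrite /S1 /norm2 /dotp /= => Sa.
have [h|h] := eqVneq a1 (-1).
  have a20 : a2 = 0.
    apply/eqP; rewrite -sqrf_eq0; apply/eqP.
    by move: Sa; rewrite h => Sa; rewrite expr2; lra.
  exists (0, 1); first by case=> /eqP; rewrite oner_eq0.
  rewrite /circle_point /scalep /norm2 /dotp /= h a20.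
  by congr pair; field.
have h1 : 1 + a1 != 0 by apply: contra h => /eqP h; apply/eqP; lra.
exists (1 + a1, a2); first by case=> /eqP; rewrite (negbTE h1).
have e : norm2 ((1 + a1, a2) : pt R) = 2 * (1 + a1).
  by rewrite /norm2 /dotp /=; lra.
rewrite /circle_point /scalep e /=; congr pair; last by field.
have -> : (1 + a1) ^+ 2 - a2 ^+ 2 = 2 * a1 * (1 + a1) by rewrite !expr2; lra.
by field.
Qed.

Lemma hline_circle_point p q z : p <> (0, 0) -> q <> (0, 0) -> wedge p q <> 0 ->
  hline (circle_point p) (circle_point q) z <-> disk z /\ lift_form z p q = 0.
Proof.
move=> p0 q0 w.
have nab : circle_point p <> circle_point q by move/circle_point_eqP => /(_ p0 q0).
have E : (1 + norm2 z) * wedge (circle_point p) (circle_point q)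
   - 2 * wedge z (subp (circle_point q) (circle_point p))
  = 2 * wedge p q / (norm2 p * norm2 q) * lift_form z p q.
  move: (norm2_gt0 p p0) (norm2_gt0 q q0) => /lt0r_neq0 hp /lt0r_neq0 hq.
  move: hp hq; rewrite /lift_form /subp /wedge /circle_point /scalep /norm2 /dotp /= => hp hq.
  by field; rewrite hp hq.
rewrite hlineP//; try exact: circle_point_S1.
split=> -[dz /eqP h]; split=> //; apply/eqP.
  move: h; rewrite -subr_eq0 E !mulf_eq0 invr_eq0 mulf_eq0 pnatr_eq0 /=.
  by rewrite (gt_eqF (norm2_gt0 p p0)) (gt_eqF (norm2_gt0 q q0)) (negbTE (introN eqP w)).
by rewrite -subr_eq0 E (eqP h) mulr0.
Qed.

(** * The half-turn about a point of the disk *)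

(** The form is the squared length of the image of [p] under a linear map of determinant
    [1 - |z|^2]. *)
Lemma lift_form_gt0 z p : disk z -> p <> (0, 0) -> 0 < lift_form z p p.
Proof.
rewrite /disk /= => dz /norm2_gt0 p0; move: dz p0.
rewrite /lift_form /norm2 /dotp; case: z p => [x y] [u v] /= dz p0.
have -> : (1 + (x * x + y * y) - 2 * x) * (u * u) + (1 + (x * x + y * y) + 2 * x) * (v * v)
  - 2 * y * (u * v + v * u)
  = ((1 - x) * u - y * v) ^+ 2 + ((1 + x) * v - y * u) ^+ 2 by ring.
rewrite lt_neqAle addr_ge0 ?sqr_ge0// andbT eq_sym; apply/eqP => /sqr_sum_eq0[h1 h2].
have d : 1 - (x * x + y * y) != 0 by rewrite subr_eq0 eq_sym lt_eqF.
have eu : (1 - (x * x + y * y)) * u = 0.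
  transitivity ((1 + x) * ((1 - x) * u - y * v) + y * ((1 + x) * v - y * u)); first by ring.
  by rewrite h1 h2; ring.
have ev : (1 - (x * x + y * y)) * v = 0.
  transitivity (y * ((1 - x) * u - y * v) + (1 - x) * ((1 + x) * v - y * u)); first by ring.
  by rewrite h1 h2; ring.
move: eu ev => /eqP + /eqP; rewrite !mulf_eq0 (negbTE d) /= => /eqP u0 /eqP v0.
by move: p0; rewrite u0 v0 !mul0r addr0 ltxx.
Qed.

Lemma lift_form_polar z p : lift_form z p (polar z p) = 0.
Proof. by rewrite /lift_form /polar /=; ring. Qed.

Lemma lift_formC z p q : lift_form z p q = lift_form z q p.
Proof. by rewrite /lift_form /=; ring. Qed.

Lemma wedge_polar z p q : wedge q (polar z p) = lift_form z p q.
Proof. by rewrite /lift_form /polar /wedge /=; ring. Qed.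

Lemma polar_neq0 z p : disk z -> p <> (0, 0) -> polar z p <> (0, 0).
Proof.
move=> dz p0 e; have := lift_form_gt0 z p dz p0.
by rewrite -wedge_polar e /wedge /= !mulr0 subrr ltxx.
Qed.

(** Were [r] proportional to [p], definiteness would forbid [lift_form z p r = 0]. This keeps
    consecutive vertices of a triangle distinct. *)
Lemma lift_form_wedge_neq0 z p r : disk z -> p <> (0, 0) -> r <> (0, 0) ->
  lift_form z p r = 0 -> wedge p r <> 0.
Proof.
move=> dz p0 r0 h w; have lp := lift_form_gt0 z p dz p0; apply: r0.
have e1 : r.1 * lift_form z p p = p.1 * lift_form z p r - wedge p r * lift_form z p (0, 1).
  by rewrite /lift_form /wedge /=; ring.
have e2 : r.2 * lift_form z p p = p.2 * lift_form z p r + wedge p r * lift_form z p (1, 0).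
  by rewrite /lift_form /wedge /=; ring.
move: e1 e2; rewrite h w !mulr0 !mul0r subrr addr0 => /eqP + /eqP.
by rewrite !mulf_eq0 (gt_eqF lp) !orbF => /eqP ? /eqP ?; apply: pt_eq.
Qed.

Lemma wedgeC p q : wedge p q = - wedge q p.
Proof. by rewrite /wedge; ring. Qed.

Lemma hline_polar z p a : disk z -> p <> (0, 0) -> S1 a -> circle_point p <> a ->
  hline (circle_point p) a z -> a = circle_point (polar z p).
Proof.
move=> dz p0 /circle_point_surj[q q0 <-] /(circle_point_eqP p q p0 q0) w.
rewrite hline_circle_point// => -[_ h].
by apply/circle_point_eqP => //; [exact: polar_neq0|rewrite wedge_polar].
Qed.

(** * Ideal triangles as roots of a quadratic form *)

Lemma hlineC a b z : hline a b z -> hline b a z.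
Proof.
case=> dz [[c [r [r0 nc ha hb hz]]]|[-> [t ez]]].
  by split=> //; left; exists c, r.
split=> //; right; split; first by rewrite /oppp /= !opprK; case: a {ez}.
by exists (- t); rewrite ez /scalep /oppp /= !mulrNN.
Qed.

Lemma hline_inj z a b c : S1 a -> S1 b -> S1 c -> a <> b -> a <> c ->
  hline a b z -> hline a c z -> b = c.
Proof.
move=> /circle_point_surj[p p0 <-] Sb Sc ab ac hb hc.
have dz : disk z by case: hb.
rewrite (hline_polar z p b dz p0 Sb ab hb).
by rewrite (hline_polar z p c dz p0 Sc ac hc).
Qed.

(** One endpoint and one point determine a line, so no point of the disk lies on two sides. The
    sides holding [P] and [Q] are thus fixed by the vertex set, and with them the vertex opposite to
    [Q]. Hence distinct roots give distinct triangles. *)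
Lemma triangle_vertex_inj P Q Rp A B C A' B' C' :
  [/\ S1 A, S1 B, S1 C & [/\ A <> B, B <> C & A <> C]] ->
  [/\ hline B C P, hline C A Q & hline A B Rp] ->
  [/\ S1 A', S1 B', S1 C' & [/\ A' <> B', B' <> C' & A' <> C']] ->
  [/\ hline B' C' P, hline C' A' Q & hline A' B' Rp] ->
  [set A; B; C] = [set A'; B'; C'] -> B = B'.
Proof.
move=> [SA SB SC [AB BC AC]] [hP hQ hR] [SA' SB' SC' [AB' BC' AC']] [hP' hQ' hR'] E.
have inV x : [set A'; B'; C'] x -> [\/ x = A, x = B | x = C].
  by rewrite -E => -[[->|->]|->]; [constructor 1|constructor 2|constructor 3].
have [eB|//|eB] := inV B' (or_introl (or_intror erefl)).
- have [eC|eC|eC] := inV C' (or_intror erefl).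
  + by case: BC'; rewrite eB eC.
  + case: AC; apply: (hline_inj P B A C) => //; first exact: nesym.
    by apply: hlineC; rewrite -eB -eC.
  + case: AB; apply: (hline_inj P C A B) => //; [exact: nesym|exact: nesym| |exact: hlineC].
    by apply: hlineC; rewrite -eB -eC.
- have eC : C' = B.
    apply: (hline_inj P C C' B) => //; [by rewrite -eB|exact: nesym|by rewrite -eB|].
    exact: hlineC.
  have eA : A' = A.
    have [//|eA|eA] := inV A' (or_introl (or_introl erefl)).
      by case: AC'; rewrite eA eC.
    by case: AB'; rewrite eA eB.
  rewrite eB; apply: (hline_inj Q A B C) => //.
  - by apply: hlineC; rewrite -eC -eA.
  - exact: hlineC.
Qed.

(* Its roots are the vertices opposite to [Q]: following the side through [P], then the
   side through [Q], then the side through [Rp] leads back to the starting vertex. *)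
Definition triangle_form P Q Rp p : R := lift_form Rp p (polar Q (polar P p)).

Definition triangle_of P Q p : set (pt R) :=
  [set circle_point (polar Q (polar P p)); circle_point p; circle_point (polar P p)].

Lemma triangle_ofP P Q Rp p : disk P -> disk Q -> disk Rp -> p <> (0, 0) ->
  triangle_form P Q Rp p = 0 ->
  let A := circle_point (polar Q (polar P p)) in
  let B := circle_point p in
  let C := circle_point (polar P p) in
  [/\ S1 A, S1 B, S1 C & [/\ A <> B, B <> C & A <> C]] /\
  [/\ hline B C P, hline C A Q & hline A B Rp].
Proof.
move=> dP dQ dR p0 h /=.
have q0 := polar_neq0 P p dP p0; have r0 := polar_neq0 Q _ dQ q0.
have w1 := lift_form_wedge_neq0 _ _ _ dP p0 q0 (lift_form_polar P p).
have w2 := lift_form_wedge_neq0 _ _ _ dQ q0 r0 (lift_form_polar Q (polar P p)).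
have w3 : wedge (polar Q (polar P p)) p <> 0.
  by apply: (lift_form_wedge_neq0 Rp) => //; rewrite lift_formC.
split; split; try exact: circle_point_S1.
- split; move/circle_point_eqP => H.
  + exact/w3/H.
  + exact/w1/H.
  + by apply: w2; rewrite wedgeC H// oppr0.
- by apply/hline_circle_point => //; split=> //; exact: lift_form_polar.
- by apply/hline_circle_point => //; split=> //; exact: lift_form_polar.
- by apply/hline_circle_point => //; split=> //; rewrite lift_formC.
Qed.

Lemma circ_ideal_trianglesE P Q Rp : disk P -> disk Q -> disk Rp ->
  circ_ideal_triangles P Q Rp =
  [set triangle_of P Q p | p in [set p | p <> (0, 0) /\ triangle_form P Q Rp p = 0]].
Proof.
move=> dP dQ dR; apply/seteqP; split=> V /=; last first.
  case=> p [p0 h] <-; have [h1 h2] := triangle_ofP _ _ _ _ dP dQ dR p0 h.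
  by do 3 eexists; split; [exact: h1|split].
case=> A [B [C [[SA SB SC [AB BC AC]] [-> [hP hQ hR]]]]].
have [p p0 eB] := circle_point_surj _ SB.
have q0 := polar_neq0 P p dP p0; have r0 := polar_neq0 Q _ dQ q0.
have eC : C = circle_point (polar P p) by apply: hline_polar; rewrite ?eB.
have eA : A = circle_point (polar Q (polar P p)).
  by apply: hline_polar; rewrite -?eC//; exact: nesym.
exists p; last by rewrite /triangle_of -eA eB -eC.
split=> //; move: hR AB; rewrite eA -eB => hR AB.
have w : wedge (polar Q (polar P p)) p <> 0 by move=> w; apply: AB; apply/circle_point_eqP.
by move: hR; rewrite hline_circle_point// lift_formC => -[].
Qed.

(** The factor is the determinant of [polar z]. *)
Lemma wedge_polar2 z p q :
  wedge (polar z p) (polar z q) = (1 - norm2 z) ^+ 2 * wedge p q.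
Proof. by rewrite /wedge /polar /norm2 /dotp /=; ring. Qed.

Lemma triangle_of_parallel P Q p q : disk P -> disk Q -> p <> (0, 0) -> q <> (0, 0) ->
  wedge p q = 0 -> triangle_of P Q p = triangle_of P Q q.
Proof.
move=> dP dQ p0 q0 w; rewrite /triangle_of.
have e x y : x <> (0, 0) -> y <> (0, 0) -> wedge x y = 0 -> circle_point x = circle_point y.
  by move=> x0 y0 xy; apply/circle_point_eqP.
have p0' := polar_neq0 P p dP p0; have q0' := polar_neq0 P q dP q0.
rewrite (e p q)// (e (polar P p) (polar P q))//; last by rewrite wedge_polar2 w mulr0.
by rewrite (e (polar Q (polar P p)) (polar Q (polar P q)))//;
  [exact: polar_neq0|exact: polar_neq0|rewrite !wedge_polar2 w !mulr0].
Qed.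

Lemma triangle_of_inj P Q Rp p q : disk P -> disk Q -> disk Rp ->
  p <> (0, 0) -> q <> (0, 0) ->
  triangle_form P Q Rp p = 0 -> triangle_form P Q Rp q = 0 ->
  triangle_of P Q p = triangle_of P Q q -> wedge p q = 0.
Proof.
move=> dP dQ dR p0 q0 hp hq E; apply/circle_point_eqP => //.
have [h1 h2] := triangle_ofP _ _ _ _ dP dQ dR p0 hp.
have [h3 h4] := triangle_ofP _ _ _ _ dP dQ dR q0 hq.
exact: (triangle_vertex_inj _ _ _ _ _ _ _ _ _ h1 h2 h3 h4 E).
Qed.

(** * Roots of binary quadratic forms *)

Definition binary_form (f : R * R * R) p : R :=
  f.1.1 * p.1 ^+ 2 + f.1.2 * (p.1 * p.2) + f.2 * p.2 ^+ 2.

Definition discr (f : R * R * R) : R := f.1.2 ^+ 2 - 4 * f.1.1 * f.2.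

Lemma discr_lt0_root f p : discr f < 0 -> binary_form f p = 0 -> p = (0, 0).
Proof.
case: f p => [[a b] c] [u v]; rewrite /discr /binary_form /= => d h.
have a0 : a != 0.
  by apply/eqP => a0; move: d; rewrite a0 mulr0 mul0r subr0 ltNge sqr_ge0.
have E : (2 * a * u + b * v) ^+ 2 = (b ^+ 2 - 4 * a * c) * v ^+ 2.
  transitivity (4 * a * (a * u ^+ 2 + b * (u * v) + c * v ^+ 2)
     + (b ^+ 2 - 4 * a * c) * v ^+ 2); first by ring.
  by rewrite h; ring.
have v0 : v = 0.
  apply/eqP; apply: contraT => v0; have v2 : 0 < v ^+ 2 by rewrite exprn_even_gt0.
  have := sqr_ge0 (2 * a * u + b * v); rewrite E leNgt.
  by rewrite nmulr_rlt0// v2.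
move/eqP: h; rewrite v0 mulr0 expr0n !mulr0 !addr0 mulf_eq0 (negbTE a0) /= sqrf_eq0.
by move=> /eqP ->.
Qed.

Lemma discr_eq0_root f : discr f = 0 -> f <> (0, 0, 0) ->
  exists2 p0, p0 <> (0, 0) & forall p, binary_form f p = 0 <-> wedge p p0 = 0.
Proof.
case: f => [[a b] c]; rewrite /discr /binary_form /wedge /= => d f0.
have [a0|a0] := eqVneq a 0.
  have b0 : b = 0 by apply/eqP; rewrite -sqrf_eq0; apply/eqP; move: d; rewrite a0; lra.
  have c0 : c != 0 by apply/eqP => c0; apply: f0; rewrite a0 b0 c0.
  exists (1, 0); first by case=> /eqP; rewrite oner_eq0.
  case=> u v /=; rewrite a0 b0 !mul0r !add0r !mulr0 mulr1 sub0r.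
  split=> [/eqP|/eqP]; first by rewrite mulf_eq0 (negbTE c0) sqrf_eq0 /= => /eqP ->; ring.
  by rewrite oppr_eq0 => /eqP ->; ring.
(* The double root [- b / (2 a)] in homogeneous coordinates. *)
exists (- b, 2 * a).
  by case=> _ /eqP; rewrite mulf_eq0 (negbTE a0) pnatr_eq0.
case=> u v /=.
have E : 4 * a * (a * u ^+ 2 + b * (u * v) + c * v ^+ 2) = (u * (2 * a) - v * - b) ^+ 2.
  transitivity ((u * (2 * a) - v * - b) ^+ 2 - (b ^+ 2 - 4 * a * c) * v ^+ 2); first by ring.
  by rewrite d; ring.
split=> h; first by apply/eqP; rewrite -sqrf_eq0 -E h mulr0.
by move/eqP: E; rewrite h expr0n /= !mulf_eq0 pnatr_eq0 (negbTE a0) /= => /eqP.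
Qed.

Lemma discr_gt0_root f : 0 < discr f ->
  exists p1 p2, [/\ p1 <> (0, 0), p2 <> (0, 0), wedge p1 p2 <> 0 &
    forall p, binary_form f p = 0 <-> wedge p p1 = 0 \/ wedge p p2 = 0].
Proof.
case: f => [[a b] c]; rewrite /discr /binary_form /wedge /= => d.
have [a0|a0] := eqVneq a 0.
  have b0 : b != 0 by apply/eqP => b0; move: d; rewrite a0 b0 expr0n mulr0 mul0r subrr ltxx.
  (* For [a = 0] the form factors as [v (b u + c v)], one root being at infinity. *)
  exists (1, 0), (c, - b); split=> //=.
  - by case=> /eqP; rewrite oner_eq0.
  - by case=> _ /eqP; rewrite oppr_eq0 (negbTE b0).
  - by apply/eqP; rewrite mul1r mul0r subr0 oppr_eq0.
  case=> u v /=; rewrite a0.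
  have -> : 0 * u ^+ 2 + b * (u * v) + c * v ^+ 2 = (u * 0 - v * 1) * (u * - b - v * c) by ring.
  split=> [/eqP|[] ->]; rewrite ?mul0r ?mulr0//.
  by rewrite mulf_eq0 => /orP[] /eqP; [left|right].
have s2 := sqr_sqrtr (ltW d); have s0 : Num.sqrt (b ^+ 2 - 4 * a * c) != 0.
  by rewrite sqrtr_eq0 -ltNge.
move: (Num.sqrt _) s2 s0 => s s2 s0.
have a20 : 2 * a != 0 by rewrite mulf_neq0 ?pnatr_eq0.
exists (- b + s, 2 * a), (- b - s, 2 * a); split=> /=.
- by case=> _ /eqP; rewrite (negbTE a20).
- by case=> _ /eqP; rewrite (negbTE a20).
- have -> : (- b + s) * (2 * a) - 2 * a * (- b - s) = 2 * (2 * a) * s by ring.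
  by apply/eqP; rewrite !mulf_neq0 ?pnatr_eq0.
case=> u v /=.
have E : 4 * a * (a * u ^+ 2 + b * (u * v) + c * v ^+ 2)
    = (u * (2 * a) - v * (- b + s)) * (u * (2 * a) - v * (- b - s)).
  transitivity ((u * (2 * a) - v * (- b + s)) * (u * (2 * a) - v * (- b - s))
    + (s ^+ 2 - (b ^+ 2 - 4 * a * c)) * v ^+ 2); first by ring.
  by rewrite s2 subrr mul0r addr0.
split=> h.
  by move/esym/eqP: E; rewrite h mulr0 mulf_eq0 => /orP[] /eqP; [left|right].
have : 4 * a * (a * u ^+ 2 + b * (u * v) + c * v ^+ 2) = 0.
  by rewrite E; case: h => ->; rewrite ?mul0r ?mulr0.
by move/eqP; rewrite !mulf_eq0 pnatr_eq0 (negbTE a0) /= => /eqP.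
Qed.

(** * Discriminant of the triangle form and number of triangles *)

(** Left unnormalized to avoid divisions: its Minkowski square is [(1 - |z|^2)^2]. *)
Definition lift z : R * pt R := (1 + norm2 z, scalep 2 z).

Definition dot3 (f g : R * pt R) : R := f.1 * g.1 + dotp f.2 g.2.

Definition cross3 (f g : R * pt R) : R * pt R :=
  (wedge f.2 g.2, (f.2.2 * g.1 - f.1 * g.2.2, f.1 * g.2.1 - f.2.1 * g.1)).

Definition lift_det P Q z : R := dot3 (cross3 (lift P) (lift Q)) (lift z).

(** As [polar] is linear, [triangle_form] is quadratic in [p], and three values recover its
    coefficients. *)
Definition triangle_coefs P Q Rp : R * R * R :=
  let F := triangle_form P Q Rp in (F (1, 0), F (1, 1) - F (1, 0) - F (0, 1), F (0, 1)).

Lemma triangle_formE P Q Rp p :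
  triangle_form P Q Rp p = binary_form (triangle_coefs P Q Rp) p.
Proof.
rewrite /triangle_coefs /binary_form /triangle_form /lift_form /polar /=.
move: (norm2 P) (norm2 Q) (norm2 Rp) => tP tQ tR; ring.
Qed.

(** The form is [wedge p (M p)] with [M] the composite of [polar P], [polar Q], [polar Rp], so its
    discriminant is [(tr M)^2 - 4 det M]. Here [det M] is the product of the [(1 - |z|^2)^2], and
    [tr M], a trace of three traceless matrices, is twice the determinant of the lifts up to
    sign. *)
Lemma discr_triangle_form P Q Rp : discr (triangle_coefs P Q Rp) =
  4 * (lift_det P Q Rp ^+ 2 - ((1 - norm2 P) * (1 - norm2 Q) * (1 - norm2 Rp)) ^+ 2).
Proof.
have N z : (1 - norm2 z) ^+ 2 = (1 + norm2 z) ^+ 2 - 4 * z.1 ^+ 2 - 4 * z.2 ^+ 2.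
  by rewrite /norm2 /dotp; ring.
rewrite !exprMn !N /lift_det /dot3 /cross3 /lift /scalep /discr /triangle_coefs.
rewrite /triangle_form /lift_form /polar /wedge /dotp /=.
move: (norm2 P) (norm2 Q) (norm2 Rp) => tP tQ tR; ring.
Qed.

(* If the form vanished, [polar Q \o polar P] would be a multiple of [polar Rp],
   hence traceless; but its trace is, up to a constant, the Minkowski product of
   [lift P] and [lift Q], which is positive. *)
Lemma triangle_coefs_neq0 P Q Rp : disk P -> disk Q -> disk Rp ->
  triangle_coefs P Q Rp <> (0, 0, 0).
Proof.
move=> dP dQ dR [ha hb hc].
(* Contracting with the adjugate of the Gram matrix of [lift_form Rp] cancels the factor [polar Rp]
   and leaves the trace, times [(1 - |Rp|^2)^2]. *)
have E : (1 + norm2 Rp + 2 * Rp.1) * (triangle_coefs P Q Rp).1.1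
    + (1 + norm2 Rp - 2 * Rp.1) * (triangle_coefs P Q Rp).2
    + 2 * Rp.2 * (triangle_coefs P Q Rp).1.2
    = - (2 * (1 - norm2 Rp) ^+ 2 * ((1 - norm2 P) * (1 - norm2 Q) + 2 * norm2 (subp P Q))).
  have -> : (1 - norm2 Rp) ^+ 2 = (1 + norm2 Rp) ^+ 2 - 4 * Rp.1 ^+ 2 - 4 * Rp.2 ^+ 2.
    by rewrite /norm2 /dotp; ring.
  have -> : (1 - norm2 P) * (1 - norm2 Q) + 2 * norm2 (subp P Q)
     = (1 + norm2 P) * (1 + norm2 Q) - 4 * (P.1 * Q.1 + P.2 * Q.2).
    by rewrite /norm2 /subp /dotp /=; ring.
  rewrite /triangle_coefs /triangle_form /lift_form /polar /=.
  move: (norm2 P) (norm2 Q) (norm2 Rp) => tP tQ tR; ring.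
move: E; rewrite /triangle_coefs /= hb ha hc !mulr0 !addr0 => /eqP.
rewrite eq_sym oppr_eq0; apply/negP.
move: dP dQ dR; rewrite /disk /= => dP dQ dR.
by rewrite gt_eqF// !mulr_gt0// ?exprn_gt0 ?subr_gt0// ltr_wpDr ?mulr_ge0 ?norm2_ge0// mulr_gt0 ?subr_gt0.
Qed.

Lemma card_set2 (T : Type) (x y : T) : x <> y -> ([set x; y] #= `I_2)%card.
Proof.
move=> xy; have <- : [set (if i is 0%N then x else y) | i in `I_2] = [set x; y].
  apply/seteqP; split=> z /=.
    by case=> [[|[|]]] // _ <-; [left|right].
  by case=> ->; [exists 0%N|exists 1%N].
by apply: inj_card_eq; move=> [|[|i]] [|[|j]] //; rewrite !inE //= => _ _ /esym.
Qed.

Lemma card_circ_triangles P Q Rp : disk P -> disk Q -> disk Rp ->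
  let N := (1 - norm2 P) * (1 - norm2 Q) * (1 - norm2 Rp) in
  [/\ lift_det P Q Rp ^+ 2 < N ^+ 2 -> (circ_ideal_triangles P Q Rp #= `I_0)%card,
      lift_det P Q Rp ^+ 2 = N ^+ 2 -> (circ_ideal_triangles P Q Rp #= `I_1)%card &
      N ^+ 2 < lift_det P Q Rp ^+ 2 -> (circ_ideal_triangles P Q Rp #= `I_2)%card].
Proof.
move=> dP dQ dR N; rewrite circ_ideal_trianglesE//; split=> h.
- rewrite II0 card_eq0; apply/eqP; rewrite -subset0 => V [p [p0]] + _.
  rewrite triangle_formE => /discr_lt0_root E; apply: p0; apply: E.
  by rewrite discr_triangle_form pmulr_rlt0 // subr_lt0.
- have [|p0 p00 E] := discr_eq0_root (triangle_coefs P Q Rp) _ (triangle_coefs_neq0 _ _ _ dP dQ dR).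
    by rewrite discr_triangle_form h subrr mulr0.
  suff -> : [set triangle_of P Q p | p in [set p | p <> (0, 0) /\ triangle_form P Q Rp p = 0]]
      = [set triangle_of P Q p0] by exact: card_set1.
  apply/seteqP; split=> V /=.
    by case=> p [p1]; rewrite triangle_formE E => w <-; exact: triangle_of_parallel.
  by move=> ->; exists p0 => //; split=> //; rewrite triangle_formE E /wedge; ring.
- have [|p1 [p2 [p10 p20 w E]]] := discr_gt0_root (triangle_coefs P Q Rp).
    by rewrite discr_triangle_form mulr_gt0 // subr_gt0.
  have r1 : triangle_form P Q Rp p1 = 0.
    by rewrite triangle_formE E; left; rewrite /wedge; ring.
  have r2 : triangle_form P Q Rp p2 = 0.
    by rewrite triangle_formE E; right; rewrite /wedge; ring.
  suff -> : [set triangle_of P Q p | p in [set p | p <> (0, 0) /\ triangle_form P Q Rp p = 0]]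
      = [set triangle_of P Q p1; triangle_of P Q p2].
    by apply: card_set2 => e; apply: w; exact: (triangle_of_inj P Q Rp).
  apply/seteqP; split=> V /=.
    by case=> p [p0]; rewrite triangle_formE E => -[] w' <-; [left|right];
      exact: triangle_of_parallel.
  by case=> ->; [exists p1|exists p2].
Qed.

(** * The two arcs in terms of the lifted determinant *)

(** The triple product expansion makes the cross product of [f] with [cross3 p q] vanish; [f] is
    then its own projection on [cross3 p q]. *)
Lemma perp_cross3 (p q f : R * pt R) : dot3 f p = 0 -> dot3 f q = 0 ->
  dot3 (cross3 p q) (cross3 p q) <> 0 ->
  exists t : R, f = (t * (cross3 p q).1, scalep t (cross3 p q).2).
Proof.
move=> fp fq m0.
have e : cross3 f (cross3 p q) = (0, (0, 0)).
  transitivity (p.1 * dot3 f q - q.1 * dot3 f p,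
    (p.2.1 * dot3 f q - q.2.1 * dot3 f p, p.2.2 * dot3 f q - q.2.2 * dot3 f p)).
    by rewrite /cross3 /dot3 /dotp /wedge /=; congr (_, (_, _)); ring.
  by rewrite fp fq !mulr0 !subrr.
move: (cross3 p q) m0 e => m m0 e.
exists (dot3 f m / dot3 m m); move/eqP: m0 => m0.
case: f m e m0 {fp fq} => [f0 [f1 f2]] [m0 [m1 m2]].
rewrite /cross3 /dot3 /dotp /wedge /scalep /= => -[e0 e1 e2] mm.
set D := (X in _ / X); rewrite -/D in mm.
have E0 : f0 * D = (f0 * m0 + (f1 * m1 + f2 * m2)) * m0.
  transitivity ((f0 * m0 + (f1 * m1 + f2 * m2)) * m0
     + (f0 * m1 - f1 * m0) * m1 - (f2 * m0 - f0 * m2) * m2); first by rewrite /D; ring.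
  by rewrite e1 e2; ring.
have E1 : f1 * D = (f0 * m0 + (f1 * m1 + f2 * m2)) * m1.
  transitivity ((f0 * m0 + (f1 * m1 + f2 * m2)) * m1
     - (f0 * m1 - f1 * m0) * m0 + (f1 * m2 - f2 * m1) * m2); first by rewrite /D; ring.
  by rewrite e0 e2; ring.
have E2 : f2 * D = (f0 * m0 + (f1 * m1 + f2 * m2)) * m2.
  transitivity ((f0 * m0 + (f1 * m1 + f2 * m2)) * m2
     + (f2 * m0 - f0 * m2) * m0 - (f1 * m2 - f2 * m1) * m1); first by rewrite /D; ring.
  by rewrite e0 e1; ring.
by congr (_, (_, _)); rewrite mulrAC -?E0 -?E1 -?E2 mulfK.
Qed.

(** A Minkowski Gram determinant, [(K + 2 d)^2 - K^2] with [K = (1 - |P|^2) (1 - |Q|^2)] and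
    [d = |P - Q|^2]. Its positivity makes the normal of the plane over [PQ] spacelike. *)
Lemma cross3_lift_norm P Q :
  norm2 (cross3 (lift P) (lift Q)).2 - (cross3 (lift P) (lift Q)).1 ^+ 2 =
  4 * norm2 (subp P Q) * ((1 - norm2 P) * (1 - norm2 Q) + norm2 (subp P Q)).
Proof. by rewrite /cross3 /lift /wedge /scalep /subp /norm2 /dotp /=; ring. Qed.

Lemma norm2_subp_gt0 P Q : P <> Q -> 0 < norm2 (subp P Q).
Proof.
move=> PQ; apply: norm2_gt0; case=> /eqP + /eqP; rewrite !subr_eq0 => /eqP h1 /eqP h2.
exact/PQ/pt_eq.
Qed.

(** With [y = expR (arccosh X)] the cosine is [sin (2 atan y) = 2 y / (1 + y^2)], while
    [y^2 - 2 X y + 1 = 0]. *)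
Lemma cos_gudermannian (X : R) : 1 < X ->
  cos (2 * atan (expR (arccosh X)) - pi / 2) = X^-1.
Proof.
move=> X1; rewrite /arccosh; set s := Num.sqrt _.
have s2 : s ^+ 2 = X ^+ 2 - 1.
  by rewrite sqr_sqrtr// subr_ge0 -[leLHS](expr1n _ 2) ler_sqr ?nnegrE; lra.
have s0 : 0 <= s := sqrtr_ge0 _.
have y0 : 0 < X + s by lra.
have yq : 1 + (X + s) ^+ 2 = 2 * X * (X + s).
  transitivity (1 + s ^+ 2 + 2 * X * s + X ^+ 2); first by ring.
  by rewrite s2; ring.
rewrite lnK ?posrE//; move: (X + s) y0 yq => y y0 yq.
have c0 : Num.sqrt (1 + y ^+ 2) != 0.
  by rewrite gt_eqF// sqrtr_gt0 ltr_wpDr ?sqr_ge0.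
have sE : sin (atan y) = y * cos (atan y).
  by have := atanK y; rewrite /tan => {2}<-; rewrite mulfVK// cos_atan invr_eq0.
rewrite cosBpihalf mulr_natl sin_mulr2n sE cos_atan.
have -> : (Num.sqrt (1 + y ^+ 2))^-1 * (y * (Num.sqrt (1 + y ^+ 2))^-1)
   = y / Num.sqrt (1 + y ^+ 2) ^+ 2 by field.
rewrite sqr_sqrtr; last by rewrite addr_ge0 ?sqr_ge0.
have Xn : X != 0 by rewrite gt_eqF//; lra.
by rewrite yq -mulr_natl; field; rewrite Xn gt_eqF.
Qed.

Lemma dot3_neq0 (f : R * pt R) : f.2 <> (0, 0) -> dot3 f f <> 0.
Proof.
move=> /norm2_gt0 f0; apply/eqP; rewrite gt_eqF// /dot3 -/(norm2 f.2) -expr2.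
by rewrite ltr_wpDl ?sqr_ge0.
Qed.

(** The plane spanned by [lift P] and [lift Q] is also spanned by the null vectors [(1, T1)] and
    [(1, T2)], so the two normals are parallel. *)
Lemma cross3_endpoints P Q T1 T2 : disk P -> disk Q -> P <> Q ->
  S1 T1 -> S1 T2 -> T1 <> T2 -> hline T1 T2 P -> hline T1 T2 Q ->
  exists2 t : R, t <> 0 & cross3 (1, T1) (1, T2) =
    (t * (cross3 (lift P) (lift Q)).1, scalep t (cross3 (lift P) (lift Q)).2).
Proof.
move=> dP dQ PQ S_1 S_2 T12 /(hlineP _ _ _ S_1 S_2 T12)[_ hP] /(hlineP _ _ _ S_1 S_2 T12)[_ hQ].
have on z : (1 + norm2 z) * wedge T1 T2 = 2 * wedge z (subp T2 T1) ->
    dot3 (cross3 (1, T1) (1, T2)) (lift z) = 0.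
  move=> /eqP; rewrite -subr_eq0 => /eqP E; rewrite -{}[RHS]E.
  by rewrite /dot3 /cross3 /lift /wedge /subp /dotp /scalep /=; ring.
have [|t E] := perp_cross3 _ _ _ (on P hP) (on Q hQ).
  apply: dot3_neq0 => n0; have := cross3_lift_norm P Q; rewrite n0.
  have K0 : 0 < (1 - norm2 P) * (1 - norm2 Q) by rewrite mulr_gt0 ?subr_gt0.
  have d0 := norm2_subp_gt0 _ _ PQ.
  have : 0 < 4 * norm2 (subp P Q) * ((1 - norm2 P) * (1 - norm2 Q) + norm2 (subp P Q)).
    by apply: mulr_gt0 (addr_gt0 K0 d0); apply: mulr_gt0 d0; rewrite ltr0n.
  have z0 : norm2 ((0, 0) : pt R) = 0 by rewrite /norm2 /dotp /=; ring.
  rewrite z0 => + e; rewrite -{}e sub0r oppr_gt0.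
  by rewrite ltNge sqr_ge0.
exists t => // t0; apply: T12; move: E; rewrite t0 /scalep !mul0r /cross3 /= => -[_ h1 h2].
by apply: pt_eq; lra.
Qed.

Lemma lift_hline P Q T1 T2 z : disk P -> disk Q -> P <> Q ->
  S1 T1 -> S1 T2 -> T1 <> T2 -> hline T1 T2 P -> hline T1 T2 Q ->
  hline T1 T2 z -> lift_det P Q z = 0.
Proof.
move=> dP dQ PQ S_1 S_2 T12 hP hQ /(hlineP _ _ _ S_1 S_2 T12)[_ hz].
have [t /eqP t0 E] := cross3_endpoints _ _ _ _ dP dQ PQ S_1 S_2 T12 hP hQ.
apply: (mulfI t0); rewrite mulr0.
transitivity (dot3 (cross3 (1, T1) (1, T2)) (lift z)).
  by rewrite E /lift_det /dot3 /scalep /dotp /=; ring.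
move/eqP: hz; rewrite -subr_eq0 => /eqP <-.
by rewrite /dot3 /cross3 /lift /wedge /subp /dotp /scalep /=; ring.
Qed.

(* [gcirc_eq] is a combination of the line [PQ] and of [S^1]; the angle condition
   fixes the ratio of the two coefficients up to sign. *)
Lemma gcircle_arc P Q T1 T2 (k : R) (w : pt R) (e : R) :
  disk P -> disk Q -> P <> Q -> S1 T1 -> S1 T2 -> T1 <> T2 ->
  hline T1 T2 P -> hline T1 T2 Q ->
  gcircle_nondeg k w e -> gcircle k w e T1 -> gcircle k w e T2 ->
  angle_with_S1 k w T1 = 2 * atan (expR (hdist P Q)) - pi / 2 ->
  exists s : bool, forall z, gcircle k w e z <->
    lift_det P Q z = (-1) ^+ s * ((1 - norm2 P) * (1 - norm2 Q) * (1 - norm2 z)).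
Proof.
move=> dP dQ PQ S_1 S_2 T12 hP hQ nd g1 g2 angle.
have [t t0 E] := cross3_endpoints _ _ _ _ dP dQ PQ S_1 S_2 T12 hP hQ.
(* On the unit circle the equation only sees [k + e] and [w]: the vector [(k + e, w)] is orthogonal
   to both [(1, T1)] and [(1, T2)]. *)
have gT T : S1 T -> gcircle k w e T -> dot3 (k + e, w) (1, T) = 0.
  by rewrite /S1 /gcircle /gcirc_eq /dot3 /= => -> <-; ring.
have [|t' E'] := perp_cross3 _ _ _ (gT _ S_1 g1) (gT _ S_2 g2).
  apply: dot3_neq0; rewrite /cross3 /= => -[h1 h2]; apply: T12; apply: pt_eq; lra.
have nu := cross3_lift_norm P Q.
have Tn : (cross3 (lift P) (lift Q)).1 + dotp (cross3 (lift P) (lift Q)).2 T1 = 0.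
  move/eqP: t0 => t0; apply: (mulfI t0); rewrite mulr0.
  transitivity (dot3 (cross3 (1, T1) (1, T2)) (1, T1)).
    by rewrite E /dot3 /scalep /dotp /=; ring.
  by rewrite /dot3 /cross3 /wedge /dotp /=; ring.
have LE z : lift_det P Q z = (cross3 (lift P) (lift Q)).1 * (1 + norm2 z)
    + 2 * dotp (cross3 (lift P) (lift Q)).2 z.
  by rewrite /lift_det /dot3 /lift /scalep /dotp /=; ring.
move: E'; rewrite E {E gT t0}.
move: (cross3 (lift P) (lift Q)) nu Tn LE => n nu Tn LE /= [ke ew].
have d0 := norm2_subp_gt0 _ _ PQ.
have K0 : 0 < (1 - norm2 P) * (1 - norm2 Q) by rewrite mulr_gt0 ?subr_gt0.
move: angle nu; rewrite /hdist.
move: (_ * (1 - norm2 Q)) (norm2 (subp P Q)) K0 d0 => K d K0 d0.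
have X1 : 1 < 1 + 2 * d / K by rewrite ltrDl divr_gt0 ?mulr_gt0.
move=> /(congr1 cos); rewrite cos_gudermannian// /angle_with_S1 /angle_normals => angle nu.
(* The coefficients in [gcirc_eq = l * lift_det + m * (1 - |z|^2)]. *)
pose l := t' * t / 2; pose m := (e - k) / 2.
have ek : k = l * n.1 - m by rewrite /l /m; lra.
have ee : e = l * n.1 + m by rewrite /l /m; lra.
have wE v : dotp w v = 2 * l * dotp n.2 v by rewrite ew /dotp /scalep /l /=; field.
have nw : norm2 w = 4 * l ^+ 2 * norm2 n.2.
  by rewrite ew /norm2 /dotp /scalep /l /=; field.
clearbody l m.
have nT : dotp n.2 T1 = - n.1 by lra.
have dN : dotp (gcirc_normal k w T1) T1 = - (2 * m).
  transitivity (2 * k * norm2 T1 + dotp w T1).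
    by rewrite /gcirc_normal /norm2 /dotp /=; ring.
  by rewrite S_1 wE nT ek; ring.
have nN : norm2 (gcirc_normal k w T1) = 4 * (l ^+ 2 * (norm2 n.2 - n.1 ^+ 2) + m ^+ 2).
  transitivity (4 * k ^+ 2 * norm2 T1 + 4 * k * dotp w T1 + norm2 w).
    by rewrite /gcirc_normal /norm2 /dotp /=; ring.
  by rewrite S_1 wE nT ek nw; ring.
have nu0 : 0 < norm2 n.2 - n.1 ^+ 2.
  by rewrite nu; apply: mulr_gt0 (addr_gt0 K0 d0); apply: mulr_gt0 d0; rewrite ltr0n.
have N0 : 0 < 4 * (l ^+ 2 * (norm2 n.2 - n.1 ^+ 2) + m ^+ 2).
  have -> : 4 * (l ^+ 2 * (norm2 n.2 - n.1 ^+ 2) + m ^+ 2) = norm2 w - 4 * k * e.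
    by rewrite nw ek ee; ring.
  by rewrite subr_gt0.
move: angle; rewrite dN nN S_1 sqrtr1 mulr1 normrN.
set r := Num.sqrt _; have r0 : 0 < r by rewrite sqrtr_gt0.
have r2 : r ^+ 2 = 4 * (l ^+ 2 * (norm2 n.2 - n.1 ^+ 2) + m ^+ 2) by rewrite sqr_sqrtr// ltW.
have mr : `|2 * m| <= r.
  rewrite -ler_sqr ?nnegrE ?(ltW r0)// real_normK ?num_real// r2.
  have l2 : 0 <= l ^+ 2 * (norm2 n.2 - n.1 ^+ 2) := mulr_ge0 (sqr_ge0 _) (ltW nu0).
  have -> : (2 * m) ^+ 2 = 4 * m ^+ 2 by ring.
  by rewrite ler_pM2l ?ltr0n// lerDr.
rewrite acosK; last first.
  rewrite in_itv /= ler_pdivrMr// mul1r mr andbT (@le_trans _ _ 0)//.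
  by rewrite divr_ge0// ltW.
have dK : 1 + 2 * d / K = (K + 2 * d) / K by field; rewrite gt_eqF.
have Kd0 : K + 2 * d != 0 by rewrite gt_eqF// addr_gt0// mulr_gt0.
move=> /(congr1 (fun x => (x * (r * (K + 2 * d))) ^+ 2)).
have -> : `|2 * m| / r * (r * (K + 2 * d)) = `|2 * m| * (K + 2 * d).
  by field; rewrite gt_eqF.
have -> : (1 + 2 * d / K)^-1 * (r * (K + 2 * d)) = r * K.
  by rewrite dK; field; rewrite Kd0 gt_eqF.
rewrite !exprMn real_normK ?num_real// r2 => e4.
(* As [nu] equals [(K + 2 d)^2 - K^2], the squared angle condition
   [m^2 (K + 2 d)^2 = (l^2 nu + m^2) K^2] reduces to [m^2 nu = (l K)^2 nu]. *)
have m2 : m ^+ 2 = (l * K) ^+ 2.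
  have nu1 : norm2 n.2 - n.1 ^+ 2 != 0 by rewrite gt_eqF.
  apply: (mulIf nu1); rewrite {1}nu; lra.
have l0 : l != 0.
  apply/eqP => l0; move: N0; rewrite m2 l0 mul0r expr0n mul0r addr0 mulr0 ltxx//.
have G z : gcirc_eq k w e z = l * lift_det P Q z + m * (1 - norm2 z).
  by rewrite LE /gcirc_eq wE ek ee; ring.
move/eqP: m2; rewrite eqf_sqr => /orP[]/eqP mE; [exists true|exists false] => z.
  rewrite /gcircle /= G mE expr1; split=> [/eqP|->]; last by ring.
  have -> : l * lift_det P Q z + l * K * (1 - norm2 z) = l * (lift_det P Q z + K * (1 - norm2 z)) by ring.
  by rewrite mulf_eq0 (negbTE l0) /= => /eqP ?; lra.
rewrite /gcircle /= G mE expr0; split=> [/eqP|->]; last by ring.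
have -> : l * lift_det P Q z + - (l * K) * (1 - norm2 z) = l * (lift_det P Q z - K * (1 - norm2 z)) by ring.
by rewrite mulf_eq0 (negbTE l0) /= => /eqP ?; lra.
Qed.

(** Being on opposite sides says nothing about empty arcs; a point on the arc is what rules out two
    circles with the same sign. *)
Lemma arc_nonempty P Q (s : bool) : disk P -> disk Q -> P <> Q ->
  exists2 z, disk z &
    lift_det P Q z = (-1) ^+ s * ((1 - norm2 P) * (1 - norm2 Q) * (1 - norm2 z)).
Proof.
move=> dP dQ PQ.
set K := (1 - norm2 P) * (1 - norm2 Q); set n := cross3 (lift P) (lift Q).
have K0 : 0 < K by rewrite mulr_gt0 ?subr_gt0.
have nu : 0 < norm2 n.2 - n.1 ^+ 2.
  rewrite cross3_lift_norm -/K; have := norm2_subp_gt0 _ _ PQ => d0.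
  by apply: mulr_gt0 (addr_gt0 K0 d0); apply: mulr_gt0 d0; rewrite ltr0n.
pose c := n.1 - (-1) ^+ s * K.
have sK : ((-1) ^+ s * K) ^+ 2 = K ^+ 2 by rewrite exprMn sqrr_sign mul1r.
have r2 : Num.sqrt (norm2 n.2) ^+ 2 = norm2 n.2 by rewrite sqr_sqrtr ?norm2_ge0.
have d2 : Num.sqrt (norm2 n.2 - n.1 ^+ 2 + K ^+ 2) ^+ 2 = norm2 n.2 - n.1 ^+ 2 + K ^+ 2.
  by rewrite sqr_sqrtr// addr_ge0 ?sqr_ge0// ltW.
have r0 : `|n.1| < Num.sqrt (norm2 n.2).
  by rewrite -sqrtr_sqr ltr_sqrt; [lra|have := sqr_ge0 n.1; lra].
have d0 : K < Num.sqrt (norm2 n.2 - n.1 ^+ 2 + K ^+ 2).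
  rewrite -{1}[K]gtr0_norm// -sqrtr_sqr ltr_sqrt; first lra.
  by have := sqr_ge0 K; lra.
move: (Num.sqrt (norm2 n.2 - n.1 ^+ 2 + K ^+ 2)) d2 d0 => d d2 d0.
move: (Num.sqrt (norm2 n.2)) r2 r0 => r r2 r0.
have rp : 0 < r by exact: le_lt_trans (normr_ge0 _) r0.
have S0 : 0 < r + d by lra.
(* On the line through the origin along [n.2] the equation is quadratic. This is its root of smaller
   modulus, rationalized so that a vanishing leading coefficient does no harm. *)
pose z : pt R := scalep (- c / ((r + d) * r)) n.2.
have nz : norm2 z = c ^+ 2 / (r + d) ^+ 2.
  have -> : norm2 z = (c / ((r + d) * r)) ^+ 2 * norm2 n.2.
    by rewrite /z /norm2 /scalep /dotp /=; ring.
  by rewrite -r2; field; rewrite ?gt_eqF.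
have nn : dotp n.2 z = - c / (r + d) * r.
  have -> : dotp n.2 z = - c / ((r + d) * r) * norm2 n.2.
    by rewrite /z /norm2 /scalep /dotp /=; ring.
  by rewrite -r2; field; rewrite ?gt_eqF.
exists z.
  rewrite /disk /= nz ltr_pdivrMr ?exprn_gt0// mul1r -ltr_sqrt ?exprn_gt0//.
  rewrite !sqrtr_sqr (gtr0_norm S0) /c.
  apply: le_lt_trans (ler_normB _ _) _.
  by rewrite normrM normr_sign mul1r (gtr0_norm K0) ltrD.
have -> : lift_det P Q z = n.1 * (1 + norm2 z) + 2 * dotp n.2 z.
  by rewrite /lift_det /dot3 -/n /lift /scalep /dotp /=; ring.
rewrite nn mulrA; set sk := (-1) ^+ s * K; rewrite -/sk in sK.
apply/eqP; rewrite -subr_eq0; apply/eqP.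
have -> : n.1 * (1 + norm2 z) + 2 * (- c / (r + d) * r) - sk * (1 - norm2 z)
   = c * ((sk ^+ 2 - K ^+ 2) * -1 + (d ^+ 2 - (norm2 n.2 - n.1 ^+ 2 + K ^+ 2)) - (r ^+ 2 - norm2 n.2)) / (r + d) ^+ 2.
  by rewrite nz /c -/sk; field; rewrite gt_eqF.
by rewrite sK d2 r2 !subrr !(mul0r, addr0, subr0, mulr0).
Qed.

(** * The region between the arcs *)

Lemma component_lt0 (T : topologicalType) (f : T -> R) (A : set T) x y :
  continuous f -> (forall t, A t -> f t <> 0) -> f x < 0 ->
  connected_component A x y -> f y < 0.
Proof.
move=> cf f0 fx [C [Cx CA Cc] Cy]; rewrite ltNge; apply/negP => fy.
have /connected_intervalP I : connected (f @` C).
  by apply: connected_continuous_connected => //; exact: continuous_subspaceT.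
have [t Ct /f0] : (f @` C) 0.
  by apply: (I (f x) (f y)); [exists x|exists y|rewrite (ltW fx)].
by apply; exact: CA.
Qed.

(* Vanishes in the disk exactly on the two arcs, and is negative between them. *)
Definition arc_gap P Q z : R :=
  lift_det P Q z ^+ 2 - ((1 - norm2 P) * (1 - norm2 Q) * (1 - norm2 z)) ^+ 2.

Lemma continuous_arc_gap P Q : continuous (arc_gap P Q).
Proof.
have c1 : continuous (fst : pt R -> R) by move=> z; exact: cvg_fst.
have c2 : continuous (snd : pt R -> R) by move=> z; exact: cvg_snd.
have cc (x : R) : continuous (fun _ : pt R => x) by move=> z; exact: cvg_cst.
have cn : continuous (@norm2 R).
  move=> z; rewrite /norm2 /dotp.
  by apply: cvgD; apply: cvgM; [exact: c1|exact: c1|exact: c2|exact: c2].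
have cX (f : pt R -> R) : continuous f -> continuous (fun z => f z ^+ 2).
  by move=> cf z; apply: (@cvgM _ _ _ _ f f); exact: cf.
move=> z; apply: cvgB; apply: cX => {}z.
  rewrite /lift_det /dot3 /lift /dotp /scalep; apply: cvgD.
    by apply: cvgM; [exact: cc|apply: cvgD; [exact: cc|exact: cn]].
  apply: cvgD; (apply: cvgM; first exact: cc); (apply: cvgM; first exact: cc).
    exact: c1.
  exact: c2.
by apply: cvgM; [exact: cc|apply: cvgB; [exact: cc|exact: cn]].
Qed.

(* Inverse of the passage to the Klein model, on homogeneous coordinates *)
Definition unlift (V : R * pt R) : pt R :=
  scalep (V.1 + Num.sqrt (V.1 ^+ 2 - norm2 V.2))^-1 V.2.

Lemma unlift_norm2 (V : R * pt R) (q := Num.sqrt (V.1 ^+ 2 - norm2 V.2)) :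
  0 < V.1 -> 0 < V.1 ^+ 2 - norm2 V.2 ->
  norm2 (unlift V) = (V.1 - q) / (V.1 + q).
Proof.
move=> V0 W0; have q0 : 0 < q by rewrite sqrtr_gt0.
have q2 : q ^+ 2 = V.1 ^+ 2 - norm2 V.2 by rewrite sqr_sqrtr// ltW.
have -> : norm2 (unlift V) = norm2 V.2 / (V.1 + q) ^+ 2.
  by rewrite /unlift -/q /norm2 /dotp /scalep /=; field; rewrite gt_eqF// addr_gt0.
have -> : norm2 V.2 = V.1 ^+ 2 - q ^+ 2 by rewrite q2; ring.
by field; rewrite gt_eqF// addr_gt0.
Qed.

Lemma unlift_lift z : disk z -> unlift (lift z) = z.
Proof.
move=> dz; rewrite /unlift /lift /=.
have -> : (1 + norm2 z) ^+ 2 - norm2 (scalep 2 z) = (1 - norm2 z) ^+ 2.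
  by rewrite /norm2 /dotp /scalep /=; ring.
rewrite sqrtr_sqr ger0_norm; last by rewrite subr_ge0 ltW.
have -> : 1 + norm2 z + (1 - norm2 z) = 2 by ring.
by rewrite /scalep /=; case: z {dz} => x y /=; congr pair; field.
Qed.

(** The affine segment from [lift z] at [s = 0] to [lift P] at [s = 1]; it projects to a straight
    segment of the Klein model. *)
Definition klein_seg P z (s : R) : R * pt R :=
  ((1 - s) * (1 + norm2 z) + s * (1 + norm2 P),
   ((1 - s) * (2 * z.1) + s * (2 * P.1), (1 - s) * (2 * z.2) + s * (2 * P.2))).

(** The Minkowski square expands into two squares and a cross term whose factor, the Minkowski
    product of the lifts, is positive. The term of [P] makes the last bound strict. *)
Lemma klein_seg_timelike P z s : 0 <= s <= 1 -> disk P -> disk z ->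
  let V := klein_seg P z s in
  [/\ 0 < V.1, 0 < V.1 ^+ 2 - norm2 V.2 &
      0 < s -> (1 - s) ^+ 2 * (1 - norm2 z) ^+ 2 < V.1 ^+ 2 - norm2 V.2].
Proof.
move=> /andP[s0 s1] dP dz V.
have E : V.1 ^+ 2 - norm2 V.2 = (1 - s) ^+ 2 * (1 - norm2 z) ^+ 2
    + s ^+ 2 * (1 - norm2 P) ^+ 2
    + 2 * s * (1 - s) * ((1 - norm2 P) * (1 - norm2 z) + 2 * norm2 (subp P z)).
  by rewrite /V /klein_seg /norm2 /subp /dotp /=; ring.
have p0 : 0 < 1 - norm2 P by rewrite subr_gt0.
have z0 : 0 < 1 - norm2 z by rewrite subr_gt0.
have s1' : 0 <= 1 - s by rewrite subr_ge0.
have H : 0 <= 2 * s * (1 - s) * ((1 - norm2 P) * (1 - norm2 z) + 2 * norm2 (subp P z)).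
  apply: mulr_ge0; first by rewrite mulr_ge0// mulr_ge0.
  by rewrite addr_ge0// mulr_ge0 ?norm2_ge0// ltW.
have A : 0 <= (1 - s) ^+ 2 * (1 - norm2 z) ^+ 2 by rewrite mulr_ge0 ?sqr_ge0.
have B : 0 <= s ^+ 2 * (1 - norm2 P) ^+ 2 by rewrite mulr_ge0 ?sqr_ge0.
have B' : 0 < s -> 0 < s ^+ 2 * (1 - norm2 P) ^+ 2.
  by move=> ?; rewrite mulr_gt0 ?exprn_gt0.
split.
- rewrite /V /=; have := norm2_ge0 z; have := norm2_ge0 P => nP nz.
  have h1 : 0 <= (1 - s) * norm2 z by rewrite mulr_ge0.
  have h2 : 0 <= s * norm2 P by rewrite mulr_ge0.
  have -> : (1 - s) * (1 + norm2 z) + s * (1 + norm2 P)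
     = 1 + (1 - s) * norm2 z + s * norm2 P by ring.
  by rewrite ltr_wpDr// ltr_wpDr.
- rewrite E; have [s_gt0|s_le0] := ltP 0 s; first by have := B' s_gt0; lra.
  have -> : s = 0 by apply/eqP; rewrite eq_le s0 s_le0.
  have -> : (1 - 0 : R) ^+ 2 * (1 - norm2 z) ^+ 2 = (1 - norm2 z) ^+ 2 by ring.
  by rewrite !(mulr0, mul0r, expr0n, addr0) exprn_gt0.
- by move=> /B' ?; rewrite E; lra.
Qed.

(** The determinant is linear in the lift and vanishes at [P], so it scales by [1 - s] along the
    segment, whereas the Minkowski length stays above [(1 - s) (1 - |z|^2)]. Their ratio therefore
    drops strictly, even from a point of the arcs. *)
Lemma arc_gap_klein_seg P Q z s : 0 < s <= 1 -> disk P -> disk Q -> disk z ->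
  arc_gap P Q z <= 0 -> disk (unlift (klein_seg P z s)) /\
  arc_gap P Q (unlift (klein_seg P z s)) < 0.
Proof.
move=> /andP[s0 s1] dP dQ dz gz.
have [|V0 W0 /(_ s0)] := klein_seg_timelike P z s _ dP dz; first by rewrite ltW.
have nU := unlift_norm2 _ V0 W0.
have q0 : 0 < Num.sqrt ((klein_seg P z s).1 ^+ 2 - norm2 (klein_seg P z s).2).
  by rewrite sqrtr_gt0.
have q2 := sqr_sqrtr (ltW W0).
have LU : lift_det P Q (unlift (klein_seg P z s)) * ((klein_seg P z s).1 +
    Num.sqrt ((klein_seg P z s).1 ^+ 2 - norm2 (klein_seg P z s).2))
    = 2 * (1 - s) * lift_det P Q z.
  have Vn : (klein_seg P z s).1 + Num.sqrt ((klein_seg P z s).1 ^+ 2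
      - norm2 (klein_seg P z s).2) != 0 by rewrite gt_eqF// addr_gt0.
  transitivity (2 * dot3 (cross3 (lift P) (lift Q)) (klein_seg P z s)).
    rewrite /lift_det {1}/dot3 {3}/lift nU /unlift.
    move: (klein_seg P z s) (Num.sqrt _) (cross3 _ _) Vn => V q n Vn.
    by rewrite /scalep /dot3 /dotp /=; field.
  rewrite /lift_det /dot3 /cross3 /klein_seg /lift /wedge /scalep /dotp /=.
  by move: (norm2 P) (norm2 Q) (norm2 z) => *; ring.
rewrite -q2; move: (Num.sqrt _) q0 nU LU {W0 q2} => q q0 nU LU lt_q.
have Vq : 0 < (klein_seg P z s).1 + q by rewrite addr_gt0.
move: (klein_seg P z s).1 (unlift _) V0 nU LU Vq => t u t0 nU LU tq.
have nU' : 1 - norm2 u = 2 * q / (t + q) by rewrite nU; field; rewrite gt_eqF.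
split; first by rewrite /disk /= -subr_gt0 nU' divr_gt0// mulr_gt0.
move: gz; rewrite /arc_gap nU' => gz.
have {}LU : lift_det P Q u = 2 * (1 - s) * lift_det P Q z / (t + q).
  by rewrite -LU; field; rewrite gt_eqF.
set K := (1 - norm2 P) * (1 - norm2 Q) in gz *.
have K0 : 0 < K by rewrite mulr_gt0 ?subr_gt0.
have -> : lift_det P Q u ^+ 2 - (K * (2 * q / (t + q))) ^+ 2 =
   4 / (t + q) ^+ 2 * ((1 - s) ^+ 2 * lift_det P Q z ^+ 2 - K ^+ 2 * q ^+ 2).
  by rewrite LU; field; rewrite gt_eqF.
rewrite pmulr_rlt0 ?divr_gt0 ?exprn_gt0//.
have h1 : (1 - s) ^+ 2 * lift_det P Q z ^+ 2 <= (1 - s) ^+ 2 * (K * (1 - norm2 z)) ^+ 2.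
  by rewrite ler_wpM2l ?sqr_ge0// -subr_le0.
have h2 : K ^+ 2 * ((1 - s) ^+ 2 * (1 - norm2 z) ^+ 2) < K ^+ 2 * q ^+ 2.
  by rewrite ltr_pM2l ?exprn_gt0.
rewrite subr_lt0; apply: le_lt_trans h1 _; apply: le_lt_trans h2.
by rewrite le_eqVlt; apply/orP; left; apply/eqP; ring.
Qed.

Lemma continuous_klein_seg P z s : 0 <= s <= 1 -> disk P -> disk z ->
  {for s, continuous (fun s => unlift (klein_seg P z s))}.
Proof.
move=> s01 dP dz.
have [V0 W0 _] := klein_seg_timelike P z s s01 dP dz.
have ca (x y : R) : {for s, continuous (fun s : R => (1 - s) * x + s * y)}.
  apply: cvgD; apply: cvgM; try exact: cvg_cst; try exact: cvg_id.
  by apply: cvgB; [exact: cvg_cst|exact: cvg_id].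
have cq : {for s, continuous (fun s => ((klein_seg P z s).1 + Num.sqrt
    ((klein_seg P z s).1 ^+ 2 - norm2 (klein_seg P z s).2))^-1)}.
  apply: continuousV; first by rewrite gt_eqF// addr_gt0// sqrtr_gt0.
  apply: cvgD; first exact: ca.
  apply: (@continuous_comp _ _ _ (fun s => (klein_seg P z s).1 ^+ 2 - norm2 (klein_seg P z s).2)
     (@Num.sqrt R)); last exact: sqrt_continuous.
  apply: cvgB; first by apply: cvgM; exact: ca.
  by rewrite /norm2 /dotp; apply: cvgD; apply: cvgM; exact: ca.
by apply: (@cvg_pair _ _ _ _ (nbhs (unlift (klein_seg P z s)).1)
    (nbhs (unlift (klein_seg P z s)).2)); apply: cvgM; [exact: cq|exact: ca|exact: cq|exact: ca].
Qed.

(** Apart from its start [z], the Klein segment to [P] stays where the gap is negative, hence in the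
    component of [P]; letting [s] tend to 0 from the right reaches [z]. *)
Lemma arc_gap_le0_closure P Q z (U : set (pt R)) : disk P -> disk Q -> disk z ->
  (forall u, disk u -> arc_gap P Q u < 0 -> U u) -> arc_gap P Q z <= 0 ->
  closure (connected_component U P) z.
Proof.
move=> dP dQ dz sU gz; pose c s := unlift (klein_seg P z s).
have c0 : c 0 = z.
  rewrite -[RHS]unlift_lift// /c; congr unlift.
  by rewrite /klein_seg /lift /scalep; congr (_, (_, _)); ring.
have c1 : c 1 = P.
  rewrite -[RHS]unlift_lift// /c; congr unlift.
  by rewrite /klein_seg /lift /scalep; congr (_, (_, _)); ring.
have sub : c @` `]0, 1] `<=` connected_component U P.
  apply: connected_component_max.
  - exists 1; last exact: c1.
    by rewrite /= in_itv /= ltr01 lexx.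
  - move=> _ [s s01 <-]; move: s01; rewrite /= in_itv /= => s01.
    by have [? ?] := arc_gap_klein_seg P Q z s s01 dP dQ dz gz; exact: sU.
  - apply: connected_continuous_connected.
      by apply/connected_intervalP; exact: interval_is_interval.
    apply: continuous_in_subspaceT => s; rewrite inE /= in_itv /= => /andP[s0 s1].
    by apply: continuous_klein_seg => //; rewrite ltW.
move=> B; rewrite -{1}c0 => nB.
have cB : \forall s \near (0 : R)^'+, B (c s).
  have c_cont : {for 0, continuous c} by apply: continuous_klein_seg; rewrite ?lexx ?ler01.
  have n0 : nbhs (0 : R) (c @^-1` B) := c_cont B nB.
  exact: (cvg_within _ n0).
have [s [[Bs s0] s1]] : exists s, (B (c s) /\ 0 < s) /\ s <= 1.
  apply: (@filter_ex _ (0 : R)^'+); apply: filterI; last exact: nbhs_right_le.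
  by apply: filterI => //; exact: nbhs_right_gt.
by exists (c s); split=> //; apply: sub; exists s => //=; rewrite in_itv /= s0.
Qed.

End IdealTriangles.

(** * Identification of the arcs and of the region, and the three cases *)

Theorem theorem2p3 (R : realType) (P Q Rp T1 T2 : pt R)
    (k1 : R) (w1 : pt R) (e1 : R) (k2 : R) (w2 : pt R) (e2 : R) :
  disk P -> disk Q -> disk Rp -> P <> Q -> Q <> Rp -> P <> Rp ->
  (* T1, T2: the two endpoints at infinity of the hyperbolic line through P, Q *)
  S1 T1 -> S1 T2 -> T1 <> T2 -> hline T1 T2 P -> hline T1 T2 Q ->
  (* C1, C2: arcs in D_P of generalized circles through T1 and T2 ... *)
  gcircle_nondeg k1 w1 e1 -> gcircle_nondeg k2 w2 e2 ->
  gcircle k1 w1 e1 T1 -> gcircle k1 w1 e1 T2 ->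
  gcircle k2 w2 e2 T1 -> gcircle k2 w2 e2 T2 ->
  (* ... meeting S^1 at T1 and T2 with angle 2 arctan(e^{d(P,Q)}) - pi/2 ... *)
  let alpha := 2 * atan (expR (hdist P Q)) - pi / 2 in
  angle_with_S1 k1 w1 T1 = alpha -> angle_with_S1 k1 w1 T2 = alpha ->
  angle_with_S1 k2 w2 T1 = alpha -> angle_with_S1 k2 w2 T2 = alpha ->
  let C1 := disk `&` gcircle k1 w1 e1 in
  let C2 := disk `&` gcircle k2 w2 e2 in
  (* ... lying on opposite sides of the hyperbolic line PQ *)
  (forall z1 z2, C1 z1 -> C2 z2 ->
     ~ connected_component (disk `\` hline T1 T2) z1 z2) ->
  (* Theta: the region of D_P bounded by C1, C2 containing the line PQ *)
  let Theta := connected_component (disk `\` (C1 `|` C2)) P in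
  let m_is := fun n : nat => (circ_ideal_triangles P Q Rp #= `I_n)%card in
  [/\ Theta Rp -> m_is 0%N,
      (C1 `|` C2) Rp -> m_is 1%N &
      (disk `\` closure Theta) Rp -> m_is 2%N].
Proof.
move=> dP dQ dR PQ QR PR S_1 S_2 T12 hP hQ nd1 nd2 g11 g12 g21 g22 alpha.
move=> a11 _ a21 _ C1 C2 opp Theta m_is.
have [s1 E1] := gcircle_arc _ _ _ _ _ _ _ _ dP dQ PQ S_1 S_2 T12 hP hQ nd1 g11 g12 a11.
have [s2 E2] := gcircle_arc _ _ _ _ _ _ _ _ dP dQ PQ S_1 S_2 T12 hP hQ nd2 g21 g22 a21.
(* With equal signs both arcs would share a point off the line [PQ], which is on the same side as
   itself. *)
have s12 : s2 = ~~ s1.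
  suff : s2 <> s1 by case: s1 s2 {E1 E2} => -[].
  move=> e12; rewrite {}e12 in E2.
  have [z dz hz] := arc_nonempty _ _ _ s1 dP dQ PQ.
  apply: (opp z z); [by split=> //; apply/E1|by split=> //; apply/E2|].
  apply: connected_component_refl; split=> // zl.
  move: hz; rewrite (lift_hline _ _ _ _ _ _ dP dQ PQ S_1 S_2 T12 hP hQ zl) => /esym/eqP.
  rewrite !mulf_eq0 signr_eq0 /= !subr_eq0.
  by rewrite !gt_eqF.
have gapE z : disk z -> arc_gap _ P Q z = 0 <-> (C1 `|` C2) z.
  move=> dz; rewrite /arc_gap; split.
    move=> /eqP; rewrite subr_eq0 eqf_sqr => /orP[] /eqP h.
      case: s1 E1 s12 => E1 s12; rewrite s12 in E2.
        by right; split=> //; apply/E2; rewrite expr0 mul1r.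
      by left; split=> //; apply/E1; rewrite expr0 mul1r.
    case: s1 E1 s12 => E1 s12; rewrite s12 in E2.
      by left; split=> //; apply/E1; rewrite expr1 mulN1r.
    by right; split=> //; apply/E2; rewrite expr1 mulN1r.
  by case=> -[_]; [move/E1|move/E2] => ->; rewrite exprMn sqrr_sign mul1r subrr.
have gapP : arc_gap _ P Q P < 0.
  rewrite /arc_gap (lift_hline _ _ _ _ _ _ dP dQ PQ S_1 S_2 T12 hP hQ hP).
  by rewrite expr0n sub0r oppr_lt0 exprn_gt0// !mulr_gt0 ?subr_gt0.
have [m0 m1 m2] := card_circ_triangles _ _ _ _ dP dQ dR.
split=> [TR|CR|[_ TR]].
(* [Theta] avoids the zeros of the gap, so the negative sign at [P] carries over to [Rp]. *)
- apply: m0; rewrite -subr_lt0.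
  apply: (component_lt0 _ _ _ _ _ _ (continuous_arc_gap _ P Q) _ gapP TR).
  by move=> z [dz nz] /(gapE _ dz).
- by apply: m1; apply/eqP; rewrite -subr_eq0; apply/eqP/gapE.
(* A nonpositive gap would put [Rp] in the closure of [Theta]. *)
- apply: m2; rewrite -subr_gt0 ltNge; apply/negP => gap; apply: TR.
  apply: arc_gap_le0_closure gap => //= u du gu; split=> //.
  by move/(gapE _ du) => e; rewrite e ltxx in gu.
Qed.
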